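(* Let $n\ge 3$ be an integer and let $P\subset\mathbb{E}^n$ be an $n$-dimensional centrally symmetric convex polytope (centered at the origin) with $m$ facets. Then $$\varphi(P,\mathbf{p},\mathbf{q})\le \tfrac14 m^2+\tfrac1{27}m^3$$ holds for any pair of distinct points $\mathbf{p},\mathbf{q}\in\mathbb{E}^n$.
   Context: $\mathbb{E}^n$ is $n$-dimensional Euclidean space with inner product $\langle\cdot,\cdot\rangle$ and origin $\mathbf{o}$. A centrally symmetric convex body is a compact convex set $C$ with nonempty interior and $C=-C$; it defines the norm $\|\mathbf{x}\|_C=\min\{\lambda\ge 0:\mathbf{x}\in\lambda C\}$, and $\|\mathbf{x},\mathbf{y}\|_C=\|\mathbf{y}-\mathbf{x}\|_C$. For distinct points $\mathbf{p},\mathbf{q}$ let $H(\mathbf{p},\mathbf{q})=\{\mathbf{y}:\langle\mathbf{y},\mathbf{q}-\mathbf{p}\rangle=0\}$, and for $\mathbf{x}\in H(\mathbf{p},\mathbf{q})$ let $S(C,\mathbf{p},\mathbf{q},\mathbf{x})$ be the set of points $\mathbf{y}$ on the line $\{\mathbf{x}+\lambda(\mathbf{q}-\mathbf{p}):\lambda\in\mathbb{R}\}$ with $\|\mathbf{p},\mathbf{y}\|_C=\|\mathbf{q},\mathbf{y}\|_C$. It is known that this set is always a single point or a closed segment; let $\overline{\mathbf{x}}$ denote its midpoint. The Minkowski bisector is $B(C,\mathbf{p},\mathbf{q})=\{\overline{\mathbf{x}}:\mathbf{x}\in H(\mathbf{p},\mathbf{q})\}$. For a centrally symmetric polytope $P$,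 $\varphi(P,\mathbf{p},\mathbf{q})$ denotes the minimal number $k$ such that $B(P,\mathbf{p},\mathbf{q})$ can be divided into (written as a union of) $k$ planar pieces, a planar piece being a closed convex subset of $B(P,\mathbf{p},\mathbf{q})$ contained in a hyperplane of $\mathbb{E}^n$. *)

(* Defs.v *)
From HB Require Import structures.
From mathcomp Require Import all_boot all_order all_algebra.
From mathcomp Require Import all_classical all_reals all_analysis.

Set Implicit Arguments.
Unset Strict Implicit.
Unset Printing Implicit Defensive.

Import Order.TTheory GRing.Theory Num.Theory.
Import numFieldNormedType.Exports.

Local Open Scope classical_set_scope.
Local Open Scope ring_scope.

Section Euclidean.
Context {R : realType} {n : nat}.
Implicit Types (p q x y z a : 'rV[R]_n) (A C P B F S : set 'rV[R]_n).

Definition inner x y : R := \sum_(i < n) x 0 i * y 0 i.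

Definition hyperplane a (b : R) : set 'rV[R]_n := [set y | inner a y = b].

Definition segment x y : set 'rV[R]_n :=
  [set (1 - t) *: x + t *: y | t in `[0, 1]%classic].

Definition conv_hull (k : nat) (v : 'I_k -> 'rV[R]_n) : set 'rV[R]_n :=
  [set x | exists c : 'I_k -> R,
     [/\ forall i, 0 <= c i, \sum_(i < k) c i = 1
       & x = \sum_(i < k) c i *: v i]].

Definition aff_indep (k : nat) (v : 'I_k -> 'rV[R]_n) : Prop :=
  forall c : 'I_k -> R, \sum_(i < k) c i = 0 ->
    \sum_(i < k) c i *: v i = 0 -> forall i, c i = 0.

(* [A] has affine dimension [d]: [d.+1] is the largest size of an affinely
   independent family in [A]. The empty set has no dimension. *)
Definition has_dim A (d : nat) : Prop :=
  (exists v : 'I_d.+1 -> 'rV[R]_n, (forall i, A (v i)) /\ aff_indep v) /\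
  ~ (exists v : 'I_d.+2 -> 'rV[R]_n, (forall i, A (v i)) /\ aff_indep v).

Definition polytope P : Prop :=
  exists k (v : 'I_k -> 'rV[R]_n), P = conv_hull v.

Definition centrally_symmetric C : Prop := C = [set - x | x in C].

Definition facets P : set (set 'rV[R]_n) :=
  [set F | (exists a b, [/\ a != 0, P `<=` [set y | inner a y <= b]
                          & F = P `&` hyperplane a b])
           /\ has_dim F n.-1].

(* When [C] is a centrally symmetric convex body, this infimum is a minimum. *)
Definition body_norm C x : R :=
  inf [set l : R | 0 <= l /\ [set l *: c | c in C] x].

Definition body_dist C x y : R := body_norm C (y - x).

Definition equidistant_on_line C p q x : set 'rV[R]_n :=
  [set y | (exists l : R, y = x + l *: (q - p))
           /\ body_dist C p y = body_dist C q y].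

(* A point counts as the degenerate segment [x = y]; the midpoint of a
   segment does not depend on the order of its ends. *)
Definition is_midpoint S z : Prop :=
  exists x y, S = segment x y /\ z = 2^-1 *: (x + y).

Definition bisector C p q : set 'rV[R]_n :=
  [set z | exists2 x, hyperplane (q - p) 0 x
                    & is_midpoint (equidistant_on_line C p q x) z].

Definition planar_piece B F : Prop :=
  [/\ closed F, convex_set F, F `<=` B
    & exists a b, a != 0 /\ F `<=` hyperplane a b].

Definition divides_into B (k : nat) : Prop :=
  exists F : 'I_k -> set 'rV[R]_n,
    (forall i, planar_piece B (F i)) /\ B = \bigcup_i F i.

(* The least number of planar pieces of the bisector: the infimum of a
   nonempty set of natural numbers is attained, and the value is +oo exactly
   when there is no finite division. *)
Definition phi P p q : \bar R :=
  ereal_inf [set (k%:R)%:E | k in [set k | divides_into (bisector P p q) k]].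

End Euclidean.

(* Main.v *)
Require Import Defs.
From mathcomp Require Import all_boot all_order all_algebra.
From mathcomp Require Import all_classical all_reals all_analysis.
From mathcomp Require Import ring lra.

Import Order.TTheory GRing.Theory Num.Theory.
Import numFieldNormedType.Exports.
Local Open Scope classical_set_scope.
Local Open Scope ring_scope.

Set Implicit Arguments.
Unset Strict Implicit.
Unset Printing Implicit Defensive.

(** Write [u = q - p] and let [a_k], for [k < m], be the outer normals of the
facets of [P], scaled so that [P] is the set of [x] with [<a_k, x> <= 1] for
all [k] ([facet_representation]).  Then the norm of [P] is the maximum of the
linear forms [<a_k, .>] ([body_norm_is_max]), so that along a line in direction
[u] through [y] the distance to [p] is a maximum of affine functions,
[g s = max_k (c_k + s * d_k)] with [c_k = <a_k, y - p>] and [d_k = <a_k, u>],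
and the distance to [q] is [g (s - 1)].  Hence [y] lies on the bisector iff the
solutions of [g s = g (s - 1)] form an interval centred at [0] ([bisectorP]).

For the convex function [g] this happens in one of two ways
([equidistant_cases]).
- The values [g 0] and [g (-1)] are equal and are reached on a line [i] of
  positive slope and on a line [j] of negative slope.  The solution is then
  unique, and [y] satisfies [c_i = c_j - d_j].
- The values [g 0] and [g (-1)] are the minimum of [g], reached on a line [i]
  of slope zero.  The minimum is taken on an interval [[al, be]] whose ends are
  the crossings of the line [i] with a line [j] of negative slope and a line [l]
  of positive slope.  The solutions form the interval [[al + 1, be]], and its
  centre is [0] iff [al + be + 1 = 0].

Once the indices are fixed, all these conditions are affine inequalities in
[y], with one affine equation that moving [y] along [u] destroys; so each
pair [(i, j)] and each triple [(i, j, l)] yields one planar piece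
([crossing_planar], [flat_bottom_planar]).  If [x], [y] and [z] count the
positive, negative and zero slopes, there are [x * y + z * y * x] pieces, and
[x + y + z = m], so the bound is the inequality between arithmetic and
geometric means for two and for three numbers ([count_bound]).

The representation of [P] by its facets starts from vertices.  A point [x]
outside [P] is separated from [P] by some [a] in the polar body
([separation]); moving [a] inside the polar body without decreasing [<a, x>]
until the vertices [v_i] with [<a, v_i> = 1] span the space ([polar_vertex])
yields the normal of a facet that separates [x] from [P] as well. *)

(** * Inner product *)

Section Inner.
Context {R : realType} {n : nat}.
Implicit Types (a x y d : 'rV[R]_n).

Lemma innerC x y : inner x y = inner y x.
Proof. by apply: eq_bigr => i _; rewrite mulrC. Qed.

Lemma innerDr a x y : inner a (x + y) = inner a x + inner a y.
Proof. by rewrite -big_split; apply: eq_bigr => i _; rewrite mxE mulrDr. Qed.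

Lemma innerZr a (t : R) x : inner a (t *: x) = t * inner a x.
Proof. by rewrite mulr_sumr; apply: eq_bigr => i _; rewrite mxE mulrCA. Qed.

Lemma innerNr a x : inner a (- x) = - inner a x.
Proof. by rewrite -scaleN1r innerZr mulN1r. Qed.

Lemma innerBr a x y : inner a (x - y) = inner a x - inner a y.
Proof. by rewrite innerDr innerNr. Qed.

Lemma innerDl x y a : inner (x + y) a = inner x a + inner y a.
Proof. by rewrite innerC innerDr !(innerC a). Qed.

Lemma innerZl (t : R) x a : inner (t *: x) a = t * inner x a.
Proof. by rewrite innerC innerZr innerC. Qed.

Lemma innerBl x y a : inner (x - y) a = inner x a - inner y a.
Proof. by rewrite innerC innerBr !(innerC a). Qed.

Lemma inner0l x : inner 0 x = 0.
Proof. by rewrite -(scale0r 0) innerZl mul0r. Qed.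

Lemma inner_sumr a (I : finType) (x : I -> 'rV[R]_n) :
  inner a (\sum_i x i) = \sum_i inner a (x i).
Proof.
rewrite /inner exchange_big; apply: eq_bigr => j _.
by rewrite summxE mulr_sumr.
Qed.

Lemma inner_self_gt0 x : x != 0 -> 0 < inner x x.
Proof.
move=> x0; rewrite lt_def; apply/andP; split; last first.
  by apply: sumr_ge0 => i _; rewrite -expr2 sqr_ge0.
apply: contra x0; rewrite psumr_eq0 => [|i _]; last by rewrite -expr2 sqr_ge0.
move=> /allP x0; apply/eqP/rowP => i; apply/eqP; rewrite mxE.
by have := x0 i (mem_index_enum i); rewrite mulf_eq0 orbb.
Qed.

Lemma mulmx_tr_inner k (A : 'M[R]_(k, n)) d i :
  (A *m d^T) i 0 = inner (row i A) d.
Proof. by rewrite mxE; apply: eq_bigr => j _; rewrite !mxE. Qed.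

End Inner.

(** * Farkas' lemma and separation *)

(** Induction on the number of generators.  If the first [k] generators do not
suffice, some [x1] is nonpositive on them and positive on [z]; it is then
positive on the last generator [l], and is scaled to be [1] there.
Replacing every vector [w] by [w - <x1, w> l] amounts to testing only against
vectors orthogonal to [l], and reduces the claim to [k] generators. *)
Lemma farkas {R : realType} (n k : nat) (w : 'I_k -> 'rV[R]_n) (z : 'rV[R]_n) :
  (forall x, (forall i, inner x (w i) <= 0) -> inner x z <= 0) ->
  exists2 c : 'I_k -> R, forall i, 0 <= c i & z = \sum_i c i *: w i.
Proof.
elim: k w z => [|k IH] w z wz.
  exists (fun=> 0) => //; rewrite big_ord0; apply/eqP.
  by apply: contraT => /inner_self_gt0; rewrite ltNge wz// => -[].
pose w' i := w (lift ord_max i); pose l := w ord_max.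
have wP x : (forall i, inner x (w' i) <= 0) -> inner x l <= 0 ->
    forall i, inner x (w i) <= 0.
  by move=> w'0 l0 i; case: (unliftP ord_max i) => [j|] ->; first exact: w'0.
have bigw (c : 'I_k.+1 -> R) :
    \sum_i c i *: w i = \sum_i c (lift ord_max i) *: w' i + c ord_max *: l.
  rewrite big_ord_recr; congr (_ + _); apply: eq_bigr => i _.
  rewrite /w'; have -> // : widen_ord (leqnSn k) i = lift ord_max i.
  by apply: val_inj; rewrite /= /bump leqNgt ltn_ord.
have [w'z|] := pselect (forall x, (forall i, inner x (w' i) <= 0) -> inner x z <= 0).
  have [c c0 ->] := IH _ _ w'z.
  exists (fun i => if unlift ord_max i is Some j then c j else 0).
    by move=> i; case: unliftP.
  rewrite bigw unlift_none scale0r addr0.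
  by apply: eq_bigr => i _; rewrite liftK.
move=> /existsNP[x0 /not_implyP[w'x0 /negP]]; rewrite -ltNge => zx0.
have lx0 : 0 < inner x0 l.
  by rewrite ltNge; apply/negP => /(wP _ w'x0)/wz; rewrite leNgt zx0.
pose x1 := (inner x0 l)^-1 *: x0.
have lx1 : inner x1 l = 1 by rewrite innerZl mulVf// gt_eqF.
have zx1 : 0 < inner x1 z by rewrite innerZl mulr_gt0// invr_gt0.
have w'x1 i : inner x1 (w' i) <= 0.
  by rewrite innerZl pmulr_rle0 ?invr_gt0.
have [|c c0 zE] := IH (fun i => w' i - inner x1 (w' i) *: l) (z - inner x1 z *: l).
  move=> x wx; have /wz : forall i, inner (x - inner x l *: x1) (w i) <= 0.
    apply: wP => [i|].
      by rewrite innerBl innerZl mulrC -innerZr -innerBr.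
    by rewrite innerBl innerZl lx1 mulr1 subrr.
  by rewrite innerBl innerZl mulrC -innerZr -innerBr.
exists (fun i => if unlift ord_max i is Some j then c j
   else inner x1 z - \sum_i c i * inner x1 (w' i)).
  move=> i; case: unliftP => // _; rewrite subr_ge0 (le_trans _ (ltW zx1))//.
  by apply: sumr_le0 => j _; rewrite mulr_ge0_le0.
rewrite bigw unlift_none; under eq_bigr do rewrite liftK.
rewrite -[LHS](subrK (inner x1 z *: l)) zE.
rewrite (eq_bigr _ (fun i _ => scalerBr _ _ _)).
rewrite big_split/= -addrA; congr (_ + _).
rewrite scalerBl [LHS]addrC sumrN; congr (_ - _); rewrite scaler_suml.
by apply: eq_bigr => i _; rewrite scalerA.
Qed.

Section Polytope.
Context {R : realType} {n : nat}.
Implicit Types (a x y d : 'rV[R]_n).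

Lemma conv_hull_vertex k (v : 'I_k -> 'rV[R]_n) i : conv_hull v (v i).
Proof.
exists (fun j => (j == i)%:R); split=> [j||]; first exact: ler0n.
  by rewrite (bigD1 i)//= eqxx big1 ?addr0// => j /negPf ->.
rewrite (bigD1 i)//= eqxx scale1r big1 ?addr0// => j /negPf ->.
by rewrite scale0r.
Qed.

Lemma conv_hull_inner_le k (v : 'I_k -> 'rV[R]_n) a (b : R) :
  (forall i, inner a (v i) <= b) -> forall x, conv_hull v x -> inner a x <= b.
Proof.
move=> vb x [c [c0 c1 ->]]; rewrite inner_sumr -[b]mul1r -c1 mulr_suml.
by apply: ler_sum => i _; rewrite innerZr ler_wpM2l.
Qed.

(** Farkas' lemma for the vectors [(v_i, 1)] and [(x, 1)]: the last coordinate
forces the coefficients to add up to [1]. *)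
Lemma separation k (v : 'I_k -> 'rV[R]_n) x : ~ conv_hull v x ->
  exists a b, (forall i, inner a (v i) <= b) /\ b < inner a x.
Proof.
move=> nx.
have innerE (a y : 'rV[R]_n) (b c : 'rV[R]_1) :
    inner (row_mx a b) (row_mx y c) = inner a y + b 0 0 * c 0 0.
  rewrite /inner big_split_ord big_ord1 !row_mxEr; congr (_ + _).
  by apply: eq_bigr => i _; rewrite !row_mxEl.
pose w i : 'rV[R]_(n + 1) := row_mx (v i) 1%:M; pose z : 'rV[R]_(n + 1) := row_mx x 1%:M.
have : ~ forall y : 'rV[R]_(n + 1), (forall i, inner y (w i) <= 0) -> inner y z <= 0.
  move=> /farkas[c c0 zE]; apply: nx; exists c; split=> //.
    have /(congr1 (fun A : 'rV[R]_(n + 1) => A 0 (rshift n 0))) := zE.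
    rewrite row_mxEr summxE mxE eqxx mulr1n => ->; apply: eq_bigr => i _.
    by rewrite mxE row_mxEr mxE eqxx mulr1n mulr1.
  have /(congr1 lsubmx) := zE; rewrite row_mxKl => ->.
  apply/rowP => j; rewrite mxE !summxE; apply: eq_bigr => i _.
  by rewrite !mxE (unsplitK (inl j)).
move=> /existsNP[y /not_implyP[wy /negP]]; rewrite -ltNge => zy.
move: zy wy; rewrite -(hsubmxK y) => zy wy.
exists (lsubmx y), (- rsubmx y 0 0); split=> [i|].
  by have := wy i; rewrite innerE [1%:M 0 0]mxE eqxx mulr1n mulr1; lra.
by move: zy; rewrite innerE [1%:M 0 0]mxE eqxx mulr1n mulr1; lra.
Qed.

(** * Facets of a symmetric polytope *)

(** The [n.+1] vectors [(1, w_i)] form an invertible matrix, which would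
annihilate the nonzero vector [(- b, a)]. *)
Lemma aff_indep_not_in_hyperplane a (b : R) (w : 'I_n.+1 -> 'rV[R]_n) :
  a != 0 -> aff_indep w -> ~ forall i, inner a (w i) = b.
Proof.
move=> a0 w_indep wb.
pose M : 'M[R]_n.+1 :=
  \matrix_(i, j) if unlift ord0 j is Some j' then w i 0 j' else 1.
have M_unit : M \in unitmx.
  rewrite -row_free_unit -kermx_eq0; apply/rowV0P => c /sub_kermxP cM.
  apply/rowP => i; rewrite [RHS]mxE; apply: (w_indep (fun i => c 0 i)).
    have /rowP/(_ ord0) := cM; rewrite !mxE => cM0; rewrite -[RHS]cM0.
    by apply: eq_bigr => j _; rewrite mxE unlift_none mulr1.
  apply/rowP => l; have /rowP/(_ (lift ord0 l)) := cM; rewrite !mxE => cMl.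
  rewrite summxE -[RHS]cMl.
  by apply: eq_bigr => j _; rewrite !mxE liftK.
pose y : 'rV[R]_n.+1 :=
  \row_j if unlift ord0 j is Some j' then a 0 j' else - b.
have My : M *m y^T = 0.
  apply/colP => i; rewrite mulmx_tr_inner mxE /inner big_ord_recl.
  rewrite !mxE unlift_none mul1r.
  under eq_bigr do rewrite !mxE liftK.
  by rewrite -[X in _ + X]/(inner (w i) a) innerC wb addNr.
have y0 : y = 0.
  by apply: trmx_inj; rewrite -(mulKmx M_unit y^T) My mulmx0 trmx0.
case/eqP: a0; apply/rowP => j; have /rowP/(_ (lift ord0 j)) := y0.
by rewrite !mxE liftK.
Qed.

(** The origin is interior to a full-dimensional symmetric polytope: otherwise
[P] lies in a half-space bounded by a hyperplane through the origin, and by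
symmetry in that hyperplane. *)
Lemma symmetric_conv_hull_vertex_gt0 k (v : 'I_k -> 'rV[R]_n) d :
  has_dim (conv_hull v) n -> centrally_symmetric (conv_hull v) ->
  d != 0 -> exists i, 0 < inner d (v i).
Proof.
move=> [[w [Pw w_indep]] _] P_sym d0; apply: contrapT => /forallNP vd.
have dP x : conv_hull v x -> inner d x <= 0.
  by apply: conv_hull_inner_le => i; rewrite leNgt; apply/negP/vd.
apply: (@aff_indep_not_in_hyperplane d 0 w) => // i; apply/le_anti.
rewrite dP//= -oppr_le0 -innerNr dP// P_sym.
by exists (w i).
Qed.

(** The vertices outside the hyperplane [<a, .> = 1] become zero rows, so that
the rank is that of the family of vertices on the hyperplane. *)
Definition active_rows k (v : 'I_k -> 'rV[R]_n) a : 'M[R]_(k, n) :=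
  \matrix_i (if inner a (v i) == 1 then v i else 0).

(** Move [a] in a direction [d] orthogonal to all vertices on the hyperplane
[<a, .> = 1], as far as the constraints [<., v_i> <= 1] permit.  The vertices
already on the hyperplane stay there, and one that is not orthogonal to [d]
joins them. *)
Lemma active_rows_grow k (v : 'I_k -> 'rV[R]_n) a x :
  (forall d, d != 0 -> exists i, 0 < inner d (v i)) ->
  (forall i, inner a (v i) <= 1) -> (\rank (active_rows v a) < n)%N ->
  exists a', [/\ forall i, inner a' (v i) <= 1, inner a x <= inner a' x
    & (\rank (active_rows v a) < \rank (active_rows v a'))%N].
Proof.
move=> v_pos av rk; set A := active_rows v a.
have [d [d0 dx Ad]] : exists d, [/\ d != 0, 0 <= inner d x & A *m d^T = 0].
  have /rowV0Pn[d /sub_kermxP dA d0] : kermx A^T != 0.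
    by rewrite kermx_eq0 -row_leq_rank mxrank_tr -ltnNge.
  have Ad : A *m d^T = 0 by apply: trmx_inj; rewrite trmx_mul trmxK dA trmx0.
  have [dx|dx] := leP 0 (inner d x); first by exists d.
  exists (- d); split; first by rewrite oppr_eq0.
    by rewrite innerC innerNr innerC oppr_ge0 ltW.
  by rewrite linearN/= mulmxN Ad oppr0.
have active_d i : inner a (v i) = 1 -> inner d (v i) = 0.
  move=> avi; have /colP/(_ i) := Ad; rewrite mulmx_tr_inner rowK avi eqxx mxE.
  by rewrite innerC.
(* [step i] makes the i-th constraint tight; the smallest such step is taken. *)
have [i0 di0] := v_pos d d0.
pose step i := (1 - inner a (v i)) / inner d (v i).
have [i di i_min] := @arg_minP _ _ _ i0 (fun i => 0 < inner d (v i)) step di0.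
have avi : inner a (v i) < 1.
  rewrite lt_neqAle av andbT; apply/eqP => /active_d di_eq0.
  by rewrite di_eq0 ltxx in di.
have step_gt0 : 0 < step i by rewrite divr_gt0// subr_gt0.
have a'E y : inner (a + step i *: d) y = inner a y + step i * inner d y.
  by rewrite innerDl innerZl.
exists (a + step i *: d); split=> [j||].
- rewrite a'E -lerBrDl; have [dj|dj] := ltP 0 (inner d (v j)).
    by rewrite -ler_pdivlMr// i_min.
  by rewrite (le_trans (mulr_ge0_le0 (ltW step_gt0) dj))// subr_ge0.
- by rewrite a'E lerDl mulr_ge0// ltW.
have a'i : inner (a + step i *: d) (v i) = 1.
  by rewrite a'E divfK ?gt_eqF// subrKC.
apply: rank_ltmx; rewrite ltmxE; apply/andP; split.
  apply/row_subP => j; rewrite rowK; case: eqP => [avj|_]; last exact: sub0mx.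
  rewrite (_ : v j = row j (active_rows v (a + step i *: d))) ?row_sub//.
  by rewrite rowK a'E active_d// mulr0 addr0 avj eqxx.
apply/negP => /submxP[D A'D].
have : (active_rows v (a + step i *: d) *m d^T) i 0 = 0.
  by rewrite A'D -mulmxA Ad mulmx0 mxE.
rewrite mulmx_tr_inner rowK a'i eqxx innerC => di_eq0.
by rewrite di_eq0 ltxx in di.
Qed.

Lemma polar_vertex k (v : 'I_k -> 'rV[R]_n) a x :
  (forall d, d != 0 -> exists i, 0 < inner d (v i)) ->
  (forall i, inner a (v i) <= 1) ->
  exists a', [/\ forall i, inner a' (v i) <= 1, inner a x <= inner a' x
    & \rank (active_rows v a') = n].
Proof.
move=> v_pos; have [r] := ubnP (n - \rank (active_rows v a)).
elim: r a => // r IH a; rewrite ltnS => rk av.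
have [rk_lt|rk_ge] := ltnP (\rank (active_rows v a)) n; last first.
  exists a; split=> //; apply/eqP.
  by rewrite eqn_leq rk_ge rank_leq_col.
have [a1 [a1v aa1 rk1]] := active_rows_grow x v_pos av rk_lt.
have [|//|a2 [a2v a12 rk2]] := IH a1.
  exact: leq_trans (ltn_sub2l rk_lt rk1) rk.
by exists a2; split=> //; exact: le_trans aa1 a12.
Qed.

(** The normal of a facet is determined by the vertices on the facet. *)
Lemma active_rows_inj k (v : 'I_k -> 'rV[R]_n) a a' :
  \rank (active_rows v a) = n ->
  (forall i, inner a (v i) = 1 -> inner a' (v i) = 1) -> a' = a.
Proof.
move=> rk aa'; have full : row_full (active_rows v a) by apply/eqP.
apply: trmx_inj; apply: (row_full_inj full).
apply/colP => i; rewrite !mulmx_tr_inner rowK; case: eqP => [avi|_].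
  by rewrite innerC aa'// innerC avi.
by rewrite !inner0l.
Qed.

Lemma hyperplane_not_has_dim P a (b : R) : a != 0 -> P `<=` hyperplane a b ->
  ~ exists w : 'I_n.+1 -> 'rV[R]_n, (forall i, P (w i)) /\ aff_indep w.
Proof.
move=> a0 Pab [w [Pw w_indep]].
by apply: (aff_indep_not_in_hyperplane a0 w_indep) => i; apply: Pab.
Qed.

End Polytope.

(** Among the vertices on the hyperplane one can choose [n] that are linearly,
hence affinely, independent. *)
Lemma facet_of_active_rows {R : realType} (n k : nat) (v : 'I_k -> 'rV[R]_n) a :
  (0 < n)%N -> a != 0 -> (forall i, inner a (v i) <= 1) ->
  \rank (active_rows v a) = n ->
  facets (conv_hull v) (conv_hull v `&` hyperplane a 1).
Proof.
case: n v a => // n v a _ a0 av rk; split.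
  by exists a, 1; split=> // x; apply: conv_hull_inner_le.
split; last first.
  have Fa1 : conv_hull v `&` hyperplane a 1 `<=` hyperplane a 1 by move=> x [].
  exact: (hyperplane_not_has_dim a0 Fa1).
have full : row_full (active_rows v a) by apply/eqP.
pose B := rowsub (fullrankfun full) (active_rows v a).
have B_unit : B \in unitmx := fullrowsub_unit full.
have BE i : row i B = v (fullrankfun full i) /\
            inner a (v (fullrankfun full i)) = 1.
  have : row i B != 0.
    apply/eqP => Bi; have : row i B *m invmx B = 0 by rewrite Bi mul0mx.
    rewrite -row_mul mulmxV// => /rowP/(_ i); rewrite !mxE eqxx.
    by apply/eqP/oner_neq0.
  by rewrite row_rowsub rowK; case: ifP => [/eqP -> //|_]; rewrite eqxx.
exists (fun i => row i B); split=> [i|c _].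
  by have [-> avi] := BE i; split=> //; exact: conv_hull_vertex.
move=> cB i; pose u := \row_i c i.
have uB : u *m B = 0.
  by rewrite mulmx_sum_row -[RHS]cB; apply: eq_bigr => j _; rewrite mxE.
have : u = 0 by rewrite -(mulmxK B_unit u) uB mul0mx.
by move=> /rowP/(_ i); rewrite !mxE.
Qed.

Lemma facet_representation {R : realType} (n m : nat) (P : set 'rV[R]_n) :
  (0 < n)%N -> polytope P -> has_dim P n -> centrally_symmetric P ->
  (facets P #= `I_m)%card ->
  exists a : 'I_m -> 'rV[R]_n, P = [set x | forall i, inner (a i) x <= 1].
Proof.
move=> n0 [k [v ->]] P_dim P_sym P_facets; set P' := conv_hull v.
have v_pos d : d != 0 -> exists i, 0 < inner d (v i).
  exact: symmetric_conv_hull_vertex_gt0.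
have normal F : facets P' F -> exists2 a, forall i, inner a (v i) <= 1
    & F = P' `&` hyperplane a 1.
  move=> [[a [b [a0 Pab FE]]] _].
  have [i vi] := v_pos a a0.
  have b0 : 0 < b.
    by apply: (lt_le_trans vi); apply: Pab; exact: conv_hull_vertex.
  exists (b^-1 *: a) => [j|].
    rewrite innerZl mulrC ler_pdivrMr// mul1r.
    by apply: Pab; exact: conv_hull_vertex.
  rewrite FE; congr (_ `&` _); apply/seteqP.
  split=> x; rewrite /hyperplane/= innerZl; first by move=> ->; rewrite mulVf ?gt_eqF.
  by move=> bx; rewrite -[RHS]mulr1 -bx mulVKf ?gt_eqF.
have [e eF] : exists e : 'I_m -> set 'rV[R]_n,
    (forall i, facets P' (e i)) /\ (forall F, facets P' F -> exists i, e i = F).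
  have /card_set_bijP[f [f_facet _ f_surj]] := card_esym P_facets.
  exists f; split=> [i|F /f_surj[i im <-]]; first by apply: f_facet => /=.
  by exists (Ordinal im).
have /choice[a aE] : forall i, exists a, (forall j, inner a (v j) <= 1) /\
    e i = P' `&` hyperplane a 1.
  by move=> i; have [a] := normal _ (eF.1 i); exists a.
exists a; apply/seteqP; split=> x.
  by move=> Px i; apply: conv_hull_inner_le Px; exact: (aE i).1.
move=> ax; apply: contrapT => /separation[c [b [cv cx]]].
have c0 : c != 0.
  apply/eqP => c0; rewrite c0 inner0l in cx.
  have [[w [Pw _]] _] := P_dim.
  have := conv_hull_inner_le cv (Pw 0); rewrite c0 inner0l; lra.
have [i0 ci0] := v_pos c c0.
have b0 : 0 < b := lt_le_trans ci0 (cv i0).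
have [|c' [c'v c'x rk]] := @polar_vertex _ _ _ v (b^-1 *: c) x v_pos.
  by move=> i; rewrite innerZl mulrC ler_pdivrMr// mul1r.
have c'x1 : 1 < inner c' x.
  by apply: lt_le_trans c'x; rewrite innerZl mulrC ltr_pdivlMr// mul1r.
have c'0 : c' != 0.
  by apply/eqP => c'0; move: c'x1; rewrite c'0 inner0l ltNge ler01.
have [i eE] := eF.2 _ (facet_of_active_rows n0 c'0 c'v rk).
have ac' : a i = c'.
  apply: (active_rows_inj rk) => j c'j.
  have : e i (v j) by rewrite eE; split=> //; exact: conv_hull_vertex.
  by rewrite (aE i).2 => -[].
by have := ax i; rewrite ac' leNgt c'x1.
Qed.
(** * The norm as a maximum of linear forms *)

Definition is_max {R : realType} {I : Type} (f : I -> R) (M : R) : Prop :=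
  (forall i, f i <= M) /\ exists i, f i = M.

Section NormAsMaximum.
Context {R : realType} {n m : nat} (a : 'I_m -> 'rV[R]_n).
Let P : set 'rV[R]_n := [set x | forall i, inner (a i) x <= 1].

(** If all forms were nonpositive on [x], the whole ray through [x] would lie in
the bounded set [P]. *)
Lemma polytope_normal_gt0 (x : 'rV[R]_n) :
  polytope P -> x != 0 -> exists i, 0 < inner (a i) x.
Proof.
move=> [k [v PE]] x0; apply: contrapT => /forallNP ax.
pose b := \sum_(i < k) `|inner x (v i)|.
have b0 : 0 <= b by apply: sumr_ge0.
have xx := inner_self_gt0 x0.
have : P (((b + 1) / inner x x) *: x).
  move=> i; rewrite innerZr (le_trans _ ler01)// mulr_ge0_le0//.
    by rewrite divr_ge0 ?ltW// ltr_wpDl.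
  by rewrite leNgt; apply/negP/ax.
rewrite PE => /(@conv_hull_inner_le _ _ _ _ x b) => /(_ _)/wrap[i|].
  by rewrite (le_trans (ler_norm _))// /b (bigD1 i)//= lerDl sumr_ge0.
by rewrite innerZr divfK ?gt_eqF//; lra.
Qed.

Lemma body_norm_is_max (x : 'rV[R]_n) : (0 < m)%N ->
  (x != 0 -> exists i, 0 < inner (a i) x) ->
  is_max (fun i => inner (a i) x) (body_norm P x).
Proof.
move=> m0 x_pos; pose i0 := Ordinal m0.
have [i _ i_max] := @arg_maxP _ _ _ i0 xpredT (fun i => inner (a i) x) isT.
set M := inner (a i) x in i_max.
have {}i_max j : inner (a j) x <= M by exact: i_max.
have M0 : 0 <= M.
  have [x0|/x_pos[j xj]] := eqVneq x 0; first by rewrite /M x0 innerC inner0l.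
  by rewrite (le_trans (ltW xj))// i_max.
pose S := [set l : R | 0 <= l /\ [set l *: c | c in P] x].
have S_gt l : M < l -> S l.
  move=> Ml; have l0 := le_lt_trans M0 Ml; split; first exact: ltW.
  exists (l^-1 *: x); last by rewrite scalerA divff ?gt_eqF// scale1r.
  move=> j; rewrite innerZr mulrC ler_pdivrMr// mul1r.
  by rewrite (le_trans _ (ltW Ml))// i_max.
have S_lb : lbound S M.
  move=> l [l0 [c Pc xE]]; rewrite /M -xE innerZr -[leRHS]mulr1.
  by rewrite ler_wpM2l.
suff -> : body_norm P x = M by split; [move=> j; exact: i_max | exists i].
apply/le_anti/andP; split; last first.
  by apply: lb_le_inf S_lb; exists (M + 1); apply: S_gt; rewrite ltrDl.
apply/ler_addgt0Pr => e e0; apply: ge_inf; first by exists M.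
by apply: S_gt; rewrite ltrDl.
Qed.

End NormAsMaximum.

(** * The bisector along lines *)

Section BisectorOnLines.
Context {R : realType} {n : nat}.
Implicit Types (z u p q : 'rV[R]_n) (C : set 'rV[R]_n).

(** The absolute values allow [r] to be negative, since the ends of a segment
come in no particular order. *)
Lemma segment_on_line z u (r : R) :
  segment (z - r *: u) (z + r *: u) = [set z + s *: u | s in [set s | `|s| <= `|r|]].
Proof.
apply/seteqP; split=> y /=.
  move=> [t]; rewrite /= in_itv /= => /andP[t0 t1] <-.
  exists ((2 * t - 1) * r) => /=.
    by rewrite normrM ler_piMl// ler_norml; apply/andP; split; lra.
  by apply/rowP => i; rewrite !mxE; ring.
move=> [s sr <-]; have [r0|r0] := eqVneq r 0.
  move: sr; rewrite r0 normr0 normr_le0 => /eqP ->.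
  exists 0; first by rewrite /= in_itv/= lexx ler01.
  by rewrite !scale0r subr0 subr0 addr0 scale1r addr0.
have : `|s / r| <= 1 by rewrite normrM normfV ler_pdivrMr ?normr_gt0// mul1r.
rewrite ler_norml => /andP[s1 s2].
exists ((s / r + 1) / 2); first by rewrite /= in_itv/=; apply/andP; split; lra.
by apply/rowP => i; rewrite !mxE; field.
Qed.

(** A point of the bisector is characterised on its own line in direction
[q - p], without reference to the base point of the line on [H(p, q)]. *)
Lemma bisectorP C p q z : p <> q ->
  bisector C p q z <-> exists2 r, 0 <= r & forall s,
    body_dist C p (z + s *: (q - p)) = body_dist C q (z + s *: (q - p)) <-> `|s| <= r.
Proof.
move=> pq; set u := q - p.
have u0 : u != 0 by rewrite subr_eq0; apply/eqP => qp; apply: pq.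
have line_inj y s t : y + s *: u = y + t *: u -> s = t.
  move=> /addrI/eqP; rewrite -subr_eq0 -scalerBl scaler_eq0 (negPf u0) orbF subr_eq0.
  by move/eqP.
split=> [[x _ [e1 [e2 [SE zE]]]]|[r r0 rP]].
  have e1S : segment e1 e2 e1.
    exists 0; first by rewrite /= in_itv/= lexx ler01.
    by rewrite subr0 scale1r scale0r addr0.
  have e2S : segment e1 e2 e2.
    exists 1; first by rewrite /= in_itv/= lexx ler01.
    by rewrite subrr scale1r scale0r add0r.
  move: (e1S) (e2S); rewrite -SE => -[[l1 e1E] _] [[l2 e2E] _].
  pose r := (l2 - l1) / 2.
  have zE' : z = x + ((l1 + l2) / 2) *: u.
    by rewrite zE e1E e2E -/u; apply/rowP => i; rewrite !mxE; field.
  have e1z : e1 = z - r *: u.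
    by rewrite zE' e1E -/u /r; apply/rowP => i; rewrite !mxE; field.
  have e2z : e2 = z + r *: u.
    by rewrite zE' e2E -/u /r; apply/rowP => i; rewrite !mxE; field.
  exists `|r| => // s.
  have {}SE : equidistant_on_line C p q x (z + s *: u) <-> `|s| <= `|r|.
    rewrite SE e1z e2z segment_on_line; split=> [[t tr /line_inj <-]//|sr].
    by exists s.
  split=> [zs|/SE[]//]; apply/SE; split=> //.
  by exists ((l1 + l2) / 2 + s); rewrite zE' -/u scalerDl addrA.
(* The orthogonal projection of z on the hyperplane orthogonal to u. *)
pose x := z - (inner u z / inner u u) *: u.
exists x.
  rewrite /hyperplane /= -/u /x innerBr innerZr divfK ?subrr//.
  by rewrite gt_eqF// inner_self_gt0.
exists (z - r *: u), (z + r *: u); split; last first.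
  by apply/rowP => i; rewrite !mxE; field.
rewrite segment_on_line (ger0_norm r0); apply/seteqP; split=> y.
  move=> [[l ->]]; rewrite -/u => yE.
  have lE : x + l *: u = z + (l - inner u z / inner u u) *: u.
    by apply/rowP => i; rewrite /x !mxE; ring.
  by rewrite lE in yE *; exists (l - inner u z / inner u u) => //; apply/rP.
move=> [s sr <-]; split; last by apply/rP.
by exists (inner u z / inner u u + s); apply/rowP => i; rewrite /x !mxE; ring.
Qed.

End BisectorOnLines.
(** * Maxima of affine functions of one variable *)

Section MaxOfLines.
Context {R : realType} {m : nat}.
Implicit Types (c d : 'I_m -> R) (g : R -> R).

(** The line [i] is maximal at [0], the line [j] at [-1], and the two values
agree. *)
Definition crossing c d i j : Prop :=
  [/\ forall k, c k <= c i, forall k, c k - d k <= c j - d j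
    & c i = c j - d j].

(** The abscissa at which the line [j] meets the horizontal line [i]. *)
Definition flat_end c d i j : R := (c i - c j) / d j.

(** The line [i] is maximal at its crossings [al] and [be] with the lines [j]
and [l], hence between them; the last equation says that [0] is the middle of
[[al + 1, be]]. *)
Definition flat_bottom c d i j l : Prop :=
  let al := flat_end c d i j in let be := flat_end c d i l in
  [/\ forall k, c k + al * d k <= c i, forall k, c k + be * d k <= c i,
      al + 1 <= be & al + be + 1 = 0].

(** For [s > 0], a line [k] maximal at [s - 1] with [g s = g (s - 1)] has
[d k <= 0], because its value at [s] is at most [g s].  But its value at [-1]
is at most [g (-1) = g 0], and [g 0 < g s] because of the line [i]; so
[d k > 0].  The case [s < 0] is symmetric, with the line [j]. *)
Lemma crossing_equidistant c d g i j s :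
  (forall s, is_max (fun k => c k + s * d k) (g s)) ->
  0 < d i -> d j < 0 -> crossing c d i j -> g s = g (s - 1) <-> `|s| <= 0.
Proof.
move=> g_max di dj [ci cj cij]; rewrite normr_le0.
split=> [gs|/eqP ->]; last first.
  have [g0 [k gk]] := g_max 0; have [g1 [k' gk']] := g_max (0 - 1).
  have := g0 i; have := g1 j; have := ci k; have := cj k'; lra.
apply: contraT => s0; move: s0; rewrite neq_lt => /orP[s0|s0].
  have [g1 _] := g_max (s - 1); have [_ [k gk]] := g_max s.
  have g1j := g1 j; have g1k := g1 k; have ck := ci k.
  have sdj : 0 < s * d j by rewrite nmulr_rgt0.
  have dk : 0 <= d k by lra.
  have : s * d k <= 0 by rewrite mulr_le0_ge0// ltW.
  lra.
have [g0 _] := g_max s; have [_ [k gk]] := g_max (s - 1).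
have g0i := g0 i; have g0k := g0 k; have ck := cj k.
have sdi : 0 < s * d i by rewrite mulr_gt0.
have dk : d k <= 0 by lra.
have : s * d k <= 0 by rewrite mulr_ge0_le0// ltW.
lra.
Qed.

(** The function [g] is constant on [[al, be]] and larger outside.  To the right
of [be], a line maximal at [s - 1] with [g s = g (s - 1)] would be nonincreasing,
hence exceed [c i] already at [al]; to the left of [al + 1] the argument is
symmetric. *)
Lemma flat_equidistant c d g i j l al be s :
  (forall s, is_max (fun k => c k + s * d k) (g s)) ->
  d i = 0 -> d j < 0 -> 0 < d l ->
  c j + al * d j = c i -> c l + be * d l = c i ->
  (forall k, c k + al * d k <= c i) -> (forall k, c k + be * d k <= c i) ->
  al + 1 <= be -> g s = g (s - 1) <-> al + 1 <= s <= be.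
Proof.
move=> g_max di dj dl cj cl g_al g_be al_be.
have g_flat t : al <= t -> t <= be -> g t = c i.
  move=> t1 t2; have [gt [k gk]] := g_max t.
  apply/le_anti/andP; split; last by have := gt i; rewrite di mulr0 addr0.
  rewrite -gk; have [dk|dk] := leP 0 (d k).
    by apply: le_trans (g_be k); rewrite lerD2l ler_wpM2r.
  by apply: le_trans (g_al k); rewrite lerD2l ler_wnM2r// ltW.
split=> [gs|/andP[s1 s2]]; last by rewrite !g_flat//; lra.
have [g0 [k gk]] := g_max s; have [g1 [k' gk']] := g_max (s - 1).
apply/andP; split; rewrite leNgt; apply/negP => sE.
  have gj : c i < g (s - 1).
    apply: lt_le_trans (g1 j); rewrite -cj ltrD2l ltr_nM2r//; lra.
  have dk : 0 <= d k by have := g1 k; lra.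
  have : s * d k <= be * d k by rewrite ler_wpM2r//; lra.
  have := g_be k; lra.
have gl : c i < g s.
  by apply: lt_le_trans (g0 l); rewrite -cl ltrD2l ltr_pM2r.
have dk' : d k' <= 0 by have := g0 k'; lra.
have : (s - 1) * d k' <= al * d k' by rewrite ler_wnM2r//; lra.
have := g_al k'; lra.
Qed.

Lemma flat_endP c d i j : d j != 0 -> c j + flat_end c d i j * d j = c i.
Proof. by move=> dj; rewrite divfK// addrC subrK. Qed.

Lemma flat_bottom_equidistant c d g i j l s :
  (forall s, is_max (fun k => c k + s * d k) (g s)) ->
  d i = 0 -> d j < 0 -> 0 < d l -> flat_bottom c d i j l ->
  g s = g (s - 1) <-> `|s| <= flat_end c d i l.
Proof.
move=> g_max di dj dl [g_al g_be al_be al_be0].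
have cj := flat_endP c i (negbT (lt_eqF dj)).
have cl := flat_endP c i (negbT (gt_eqF dl)).
rewrite (flat_equidistant s g_max di dj dl cj cl g_al g_be al_be).
rewrite ler_norml; split=> /andP[s1 s2]; apply/andP; split; lra.
Qed.

(** Since [g 0 = g (-1)], a line maximal at [0] has slope [>= 0] and a line
maximal at [-1] has slope [<= 0].  If no horizontal line reaches this value,
both slopes are nonzero.  If the line [i] is horizontal and reaches it, the
value is the minimum of [g], and the ends of the interval where the minimum is
taken are the last crossing of [i] with a decreasing line and the first one with
an increasing line. *)
Lemma equidistant_cases c d g r :
  (forall s, is_max (fun k => c k + s * d k) (g s)) ->
  (exists i, 0 < d i) -> (exists j, d j < 0) -> 0 <= r ->
  (forall s, g s = g (s - 1) <-> `|s| <= r) ->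
  (exists i j, [/\ 0 < d i, d j < 0 & crossing c d i j]) \/
  (exists i j l, [/\ d i = 0, d j < 0, 0 < d l & flat_bottom c d i j l]).
Proof.
move=> g_max [l0 dl0] [j0 dj0] r0 gr.
have g01 : g 0 = g (- 1) by rewrite -[- 1]sub0r; apply/gr; rewrite normr0.
have [g0 [k gk]] := g_max 0; have [g1 [k' gk']] := g_max (- 1).
have [[i [di ci]]|/forallNP flat] := pselect (exists i, d i = 0 /\ c i = g 0).
  right.
  have [j dj j_max] := @arg_maxP _ _ _ j0 (fun j => d j < 0) (flat_end c d i) dj0.
  have [l dl l_min] := @arg_minP _ _ _ l0 (fun l => 0 < d l) (flat_end c d i) dl0.
  set al := flat_end c d i j in j_max; set be := flat_end c d i l in l_min.
  have al1 : al <= - 1.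
    by rewrite /al /flat_end ler_ndivrMr//; have := g1 j; lra.
  have be0 : 0 <= be.
    by apply: divr_ge0; [rewrite subr_ge0; have := g0 l; lra|exact: ltW].
  have g_al t : c t + al * d t <= c i.
    have [dt|dt|dt] := ltgtP (d t) 0.
    - have := j_max t dt; rewrite /= /flat_end ler_ndivrMr//; lra.
    - have : al * d t <= 0 by apply: mulr_le0_ge0; [lra|exact: ltW].
      have := g0 t; lra.
    - by have := g0 t; rewrite dt; lra.
  have g_be t : c t + be * d t <= c i.
    have [dt|dt|dt] := ltgtP (d t) 0.
    - have : be * d t <= 0 by apply: mulr_ge0_le0 => //; exact: ltW.
      have := g0 t; lra.
    - have := l_min t dt; rewrite /= /flat_end ler_pdivlMr//; lra.
    - by have := g0 t; rewrite dt; lra.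
  have al_be : al + 1 <= be by lra.
  have flatE s : al + 1 <= s <= be <-> `|s| <= r.
    rewrite -gr; apply: iff_sym.
    have cj := flat_endP c i (negbT (lt_eqF dj)).
    have cl := flat_endP c i (negbT (gt_eqF dl)).
    exact: (flat_equidistant s g_max di dj dl cj cl g_al g_be al_be).
  exists i, j, l; split=> //; split=> //.
  (* The intervals [-r, r] and [al + 1, be] coincide, so their ends do. *)
  have /flatE : `|r| <= r by rewrite ger0_norm.
  have /flatE : `|- r| <= r by rewrite normrN ger0_norm.
  have /flatE : al + 1 <= be <= be by rewrite al_be lexx.
  have /flatE : al + 1 <= al + 1 <= be by rewrite al_be lexx.
  rewrite !ler_norml => /andP[? ?] /andP[? ?] /andP[? ?] /andP[? ?].
  by rewrite -/al -/be; lra.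
left; exists k, k'.
have dk : 0 < d k.
  rewrite lt_neqAle; apply/andP; split.
    by apply/eqP => dk; apply: (flat k); split=> //; lra.
  by have := g1 k; lra.
have dk' : d k' < 0.
  rewrite lt_neqAle; apply/andP; split.
    by apply/eqP => dk'; apply: (flat k'); split=> //; lra.
  by have := g0 k'; lra.
split=> //; split=> [t|t|]; last by lra.
  by have := g0 t; lra.
by have := g1 t; lra.
Qed.

End MaxOfLines.
(** * Planar pieces *)

Section AffineFunctions.
Context {R : realType} {n : nat}.
Implicit Types (f g : 'rV[R]_n -> R) (A B : set 'rV[R]_n).

Definition affine f : Prop := exists a b, forall y, f y = inner a y + b.

Lemma affine_cst (b : R) : affine (fun=> b).
Proof. by exists 0, b => y; rewrite inner0l add0r. Qed.

Lemma affine_inner a p : affine (fun y => inner a (y - p)).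
Proof. by exists a, (- inner a p) => y; rewrite innerBr. Qed.

Lemma affineD f g : affine f -> affine g -> affine (fun y => f y + g y).
Proof.
move=> [a [b fE]] [a' [b' gE]]; exists (a + a'), (b + b') => y.
by rewrite fE gE innerDl addrACA.
Qed.

Lemma affineM f (t : R) : affine f -> affine (fun y => f y * t).
Proof.
move=> [a [b fE]]; exists (t *: a), (t * b) => y.
by rewrite fE innerZl mulrC mulrDr.
Qed.

Lemma affineB f g : affine f -> affine g -> affine (fun y => f y - g y).
Proof.
move=> f_aff g_aff; have := affineD f_aff (affineM (- 1) g_aff).
by congr affine; apply/funext => y; rewrite mulrN1.
Qed.

Definition closed_convex A : Prop := closed A /\ convex_set A.

Lemma closed_convex_le f g : affine f -> affine g ->
  closed_convex [set y | f y <= g y].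
Proof.
move=> f_aff g_aff; have [a [b /= fg]] := affineB f_aff g_aff.
rewrite (_ : mkset _ = [set y | inner a y <= - b]); last first.
  by apply/seteqP; split=> y /=; have := fg y; lra.
split.
  have inner_cont : continuous (inner a).
    have add_cont : continuous (fun x : R * R => x.1 + x.2).
      exact: add_continuous.
    apply: (continuous_big add_cont) => i _ y.
    by apply: continuousM; [exact: cst_continuous|exact: coord_continuous].
  apply: (@preimage_closed _ _ (inner a) [set x | x <= - b]); last exact: closed_le.
  by move=> y _; exact: inner_cont.
move=> x y t; rewrite !inE /= => ax ay.
change (inner a ((t%:num : R) *: (x : 'rV[R]_n) + (1 - t%:num) *: (y : 'rV[R]_n)) <= - b).
have t0 : 0 <= t%:num :> R by [].
have t1 : t%:num <= 1 :> R by [].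
rewrite innerDr !innerZr; nra.
Qed.

Lemma closed_convexI A B : closed_convex A -> closed_convex B ->
  closed_convex (A `&` B).
Proof.
move=> [cA vA] [cB vB]; split; first exact: closedI.
move=> x y t; rewrite !inE => -[Ax Bx] [Ay By].
by split; rewrite -in_setE; [apply: vA|apply: vB]; rewrite inE.
Qed.

Lemma closed_convex_forall I (A : I -> set 'rV[R]_n) :
  (forall i, closed_convex (A i)) -> closed_convex [set y | forall i, A i y].
Proof.
move=> cA; split.
  rewrite (_ : mkset _ = \bigcap_i A i).
    by apply: closed_bigI => i _; exact: (cA i).1.
  by apply/seteqP; split=> y /= Ay i => [_|]; exact: Ay.
move=> x y t; rewrite !inE /= => Ax Ay i; rewrite -in_setE.
by apply: (cA i).2; rewrite inE.
Qed.

Lemma closed_convex_eq f g : affine f -> affine g ->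
  closed_convex [set y | f y = g y].
Proof.
move=> f_aff g_aff.
rewrite (_ : mkset _ = [set y | f y <= g y] `&` [set y | g y <= f y]).
  by apply: closed_convexI; exact: closed_convex_le.
apply/seteqP; split=> y /=; first by move=> ->.
by move=> [fg gf]; apply/le_anti; rewrite fg gf.
Qed.

(** The values at [x] and [y] guarantee that the equation has a nonzero normal
vector. *)
Lemma affine_eq_hyperplane f g x y : affine f -> affine g ->
  f x - g x != f y - g y ->
  exists a b, a != 0 /\ [set y | f y = g y] `<=` hyperplane a b.
Proof.
move=> f_aff g_aff; have [a [b /= fg]] := affineB f_aff g_aff.
rewrite !fg => a_neq; exists a, (- b); split.
  by apply: contraNneq a_neq => ->; rewrite !inner0l.
by move=> z /= fgz; apply/eqP; rewrite -addr_eq0 -fg fgz subrr.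
Qed.

End AffineFunctions.

Section Pieces.
Context {R : realType} {n m : nat} (a : 'I_m -> 'rV[R]_n) (p u : 'rV[R]_n).
Let c y k := inner (a k) (y - p).
Let d k := inner (a k) u.

Let affine_c k : affine (fun y => c y k).
Proof. exact: affine_inner. Qed.

Let c_pu k : c (p + u) k = d k.
Proof. by rewrite /c addrAC subrr add0r. Qed.

Let c_p k : c p k = 0.
Proof. by rewrite /c subrr innerC inner0l. Qed.

Lemma crossing_planar i j B : 0 < d i -> d j < 0 ->
  [set y | crossing (c y) d i j] `<=` B ->
  planar_piece B [set y | crossing (c y) d i j].
Proof.
move=> di dj FB.
have affB k : affine (fun y => c y k - d k).
  by apply: affineB (affine_cst _).
have [closedF convexF] : closed_convex [set y | crossing (c y) d i j].
  rewrite (_ : mkset _ = [set y | forall k, c y k <= c y i] `&`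
     [set y | forall k, c y k - d k <= c y j - d j] `&`
     [set y | c y i = c y j - d j]); last first.
    by apply/seteqP; split=> y => [[]|[[]]].
  apply: closed_convexI; [apply: closed_convexI|exact: closed_convex_eq].
    by apply: closed_convex_forall => k; exact: closed_convex_le.
  by apply: closed_convex_forall => k; exact: closed_convex_le.
split=> //.
(* From p to p + u the difference of the two sides grows by d i - d j > 0. *)
have [|b [e [b0 be]]] := @affine_eq_hyperplane _ _ _ _ (p + u) p (affine_c i) (affB j).
  by rewrite !c_pu !c_p; apply/eqP => ?; lra.
exists b, e; split=> //; apply: subset_trans be => y [_ _].
by [].
Qed.

Lemma flat_bottom_planar i j l B : d i = 0 -> d j < 0 -> 0 < d l ->
  [set y | flat_bottom (c y) d i j l] `<=` B ->
  planar_piece B [set y | flat_bottom (c y) d i j l].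
Proof.
move=> di dj dl FB.
have aff_end t : affine (fun y => flat_end (c y) d i t).
  by apply: affineM; exact: affineB.
have aff_val t k : affine (fun y => c y k + flat_end (c y) d i t * d k).
  by apply: affineD => //; exact: affineM.
have aff1 : affine (fun y => flat_end (c y) d i j + 1).
  by apply: affineD => //; exact: affine_cst.
have aff_sum : affine (fun y => flat_end (c y) d i j + flat_end (c y) d i l + 1).
  by apply: affineD (affine_cst _); exact: affineD.
have [closedF convexF] : closed_convex [set y | flat_bottom (c y) d i j l].
  rewrite (_ : mkset _ =
     [set y | forall k, c y k + flat_end (c y) d i j * d k <= c y i] `&`
     [set y | forall k, c y k + flat_end (c y) d i l * d k <= c y i] `&`
     [set y | flat_end (c y) d i j + 1 <= flat_end (c y) d i l] `&`
     [set y | flat_end (c y) d i j + flat_end (c y) d i l + 1 = 0]); last first.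
    by apply/seteqP; split=> y => [[]|[[[]]]].
  apply: closed_convexI; last exact: closed_convex_eq (affine_cst _).
  apply: closed_convexI; last exact: closed_convex_le.
  by apply: closed_convexI; apply: closed_convex_forall => k;
    exact: closed_convex_le.
split=> //.
(* From p to p + u both ends of the flat part decrease by 1. *)
have [|b [e [b0 be]]] :=
    @affine_eq_hyperplane _ _ _ _ (p + u) p aff_sum (affine_cst 0).
  rewrite /flat_end !c_pu !c_p di !subrr !mul0r !sub0r !mulNr !divff//.
  - by apply/eqP => ?; lra.
  - by rewrite gt_eqF.
  - by rewrite lt_eqF.
exists b, e; split=> //; apply: subset_trans be => y [_ _ _].
by [].
Qed.

End Pieces.

(** * Counting the pieces *)

(** The inequality between arithmetic and geometric means for [x, y] and for
[x, y, z]. *)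
Lemma count_bound {R : realType} (x y z : R) : 0 <= x -> 0 <= y -> 0 <= z ->
  x * y + z * (y * x) <= 1 / 4 * (x + y + z) ^+ 2 + 1 / 27 * (x + y + z) ^+ 3.
Proof.
move=> x0 y0 z0; apply: lerD.
  have := sqr_ge0 (x - y); have := mulr_ge0 x0 z0; have := mulr_ge0 y0 z0.
  have := sqr_ge0 z; rewrite !expr2; nra.
(* For three numbers, 27 times the difference of the two sides is
   (x + y + z) ((x - y)^2 + (y - z)^2 + (z - x)^2) / 2
     + 3 (x (y - z)^2 + y (z - x)^2 + z (x - y)^2). *)
have cubes : 0 <= (x + y + z) * ((x - y) ^+ 2 + (y - z) ^+ 2 + (z - x) ^+ 2).
  by rewrite mulr_ge0 ?addr_ge0 ?sqr_ge0.
have := mulr_ge0 x0 (sqr_ge0 (y - z)); have := mulr_ge0 y0 (sqr_ge0 (z - x)).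
have := mulr_ge0 z0 (sqr_ge0 (x - y)).
lra.
Qed.

Lemma card_sign_classes {R : realType} m (d : 'I_m -> R) :
  (#|[pred i | (0 < d i)%R]| + #|[pred i | (d i < 0)%R]|
    + #|[pred i | d i == 0%R]|)%N = m.
Proof.
rewrite -!sum1_card !(big_mkcond (fun i => i \in _))/= -!big_split/=.
rewrite -[RHS]card_ord -sum1_card; apply: eq_bigr => i _; rewrite !inE.
by case: ltgtP.
Qed.

Lemma divides_into_card {R : realType} n (B : set 'rV[R]_n) (T : finType)
    (F : T -> set 'rV[R]_n) :
  (forall t, planar_piece B (F t)) -> B `<=` \bigcup_t F t ->
  divides_into B #|T|.
Proof.
move=> FB BF; exists (fun i => F (enum_val i)); split=> //.
apply/seteqP; split=> [y /BF[t _ Fty]|y [i _]]; last first.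
  by have [_ _ FiB _] := FB (enum_val i); exact: FiB.
by exists (enum_rank t) => //; rewrite enum_rankK.
Qed.

Theorem theorem2 (R : realType) (n m : nat) (P : set 'rV[R]_n)
    (n_ge3 : (3 <= n)%N)
    (P_polytope : polytope P)
    (P_dim : has_dim P n)
    (P_sym : centrally_symmetric P)
    (P_facets : (facets P #= `I_m)%card)
    (p q : 'rV[R]_n) (pq : p <> q) :
  (phi P p q <= (1 / 4 * m%:R ^+ 2 + 1 / 27 * m%:R ^+ 3)%:E)%E.
Proof.
have [a PE] := facet_representation (ltn_trans (isT : 0 < 2)%N n_ge3) P_polytope
  P_dim P_sym P_facets.
have a_pos x : x != 0 -> exists i, 0 < inner (a i) x.
  by apply: polytope_normal_gt0; rewrite -PE.
pose u := q - p; pose d k := inner (a k) u; pose c y k := inner (a k) (y - p).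
have u0 : u != 0 by rewrite subr_eq0; apply/eqP => qp; apply: pq.
have [i0 di0] : exists i, 0 < d i := a_pos u u0.
have [j0 dj0] : exists j, d j < 0.
  have [|j] := a_pos (- u); first by rewrite oppr_eq0.
  by rewrite innerNr oppr_gt0; exists j.
have m0 : (0 < m)%N := leq_ltn_trans (leq0n i0) (ltn_ord i0).
pose g y (s : R) := body_dist P p (y + s *: u).
have g_max y s : is_max (fun k => c y k + s * d k) (g y s).
  have := body_norm_is_max m0 (a_pos (y + s *: u - p)); rewrite -PE.
  congr is_max; apply/funext => k.
  by rewrite /c /d -innerZr -innerDr addrAC.
have gq y s : body_dist P q (y + s *: u) = g y (s - 1).
  congr body_norm; apply/rowP => k; rewrite !mxE; ring.
have bisectorE y : bisector P p q y <-> exists2 r, 0 <= r &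
    forall s, g y s = g y (s - 1) <-> `|s| <= r.
  rewrite (bisectorP P y pq).
  by split=> -[r r0 rP]; exists r => // s; have := rP s; rewrite gq.
pose T := ({i | 0 < d i} * {j | d j < 0%R} +
  {i | d i == 0%R} * ({j | d j < 0%R} * {l | 0 < d l}))%type.
pose F (t : T) := match t with
  | inl (i, j) => [set y | crossing (c y) d (val i) (val j)]
  | inr (i, (j, l)) => [set y | flat_bottom (c y) d (val i) (val j) (val l)]
  end.
have piecesP : divides_into (bisector P p q) #|{: T}|.
  apply: (@divides_into_card _ _ _ _ F) => [[[[i di] [j dj]]|[[i di] [[j dj] [l dl]]]]|y].
  - apply: crossing_planar => // y /= ij; apply/bisectorE; exists 0 => // s.
    exact: (crossing_equidistant s (g_max y) di dj ij).
  - move/eqP: (di) => di_eq0; apply: flat_bottom_planar => // y /= ijl.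
    apply/bisectorE; exists (flat_end (c y) d i l) => [|s].
      by case: ijl => _ _; lra.
    exact: (flat_bottom_equidistant s (g_max y) di_eq0 dj dl ijl).
  move=> /bisectorE[r r0 gr].
  have [[i [j [di dj ij]]]|[i [j [l [di dj dl ijl]]]]] :=
      equidistant_cases (g_max y) (ex_intro _ i0 di0) (ex_intro _ j0 dj0) r0 gr.
    by exists (inl (exist _ i di, exist _ j dj)).
  move/eqP: di => di.
  by exists (inr (exist _ i di, (exist _ j dj, exist _ l dl))).
apply: (@le_trans _ _ ((#|{: T}|%:R)%:E)).
  by apply: ereal_inf_lbound; exists #|{: T}|.
rewrite lee_fin card_sum !card_prod !card_sig natrD !natrM.
rewrite -(_ : #|[pred i | (0 < d i)%R]|%:R + #|[pred i | (d i < 0)%R]|%:R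
    + #|[pred i | d i == 0%R]|%:R = m%:R :> R).
  exact: count_bound.
by rewrite -!natrD card_sign_classes.
Qed.
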